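(* For every $n\geq 1$, $$D_{2n}D_{2n-1}\cdots D_1(x_0)=B_n(\mathbf{x},\mathbf{y},\mathbf{z},\mathbf{u},\mathbf{v}),$$ where $$B_n(\mathbf{x},\mathbf{y},\mathbf{z},\mathbf{u},\mathbf{v})=\sum_{\pi\in L_n}\prod_{i\in X(\pi)}x_{\pi_i}\prod_{i\in Y(\pi)}y_{\pi_i}\prod_{i\in Z(\pi)}z_{\pi_i}\prod_{i\in U(\pi)}u_{\pi_i}\prod_{i\in V(\pi)}v_{\pi_i}$$ and, for each $m\geq 1$, $D_m$ is the formal derivative associated with the context-free grammar $G_m$ given, for $n\ge 1$, by $$G_{2n-1}=\{x_i,y_i,z_i,u_i,v_i\rightarrow u_nv_n,\ 0\leq i<n\},$$ $$G_{2n}=\{x_i,y_i,z_i,u_i,v_i\rightarrow x_ny_nz_n,\ 0\leq i<n;\ \ u_n\rightarrow x_nz_nu_n,\ v_n\rightarrow x_ny_nz_n\}.$$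
   Context: The $x_i,y_i,z_i,u_i,v_i$ ($i\geq 0$) are independent commuting variables (letters). A context-free grammar $G$ is a set of production rules $\text{letter}\rightarrow\text{polynomial}$; a rule ''$x_i,y_i,z_i,u_i,v_i\to p$'' means that each of the five listed letters has the rule with right-hand side $p$. The formal derivative $D$ associated with $G$ is the linear operator on polynomials in the letters that satisfies the Leibniz rule $D(fg)=D(f)g+fD(g)$ and sends each letter to the right-hand side of its production rule. (In the expression above, each $D_m$ is only applied to polynomials in letters for which $G_m$ has a rule; letters without a rule may be sent to $0$.) For $n\geq 1$ let $M_n$ be the multiset $\{1,1,\bar 1,2,2,\bar 2,\ldots,n,n,\bar n\}$. Comparisons ($<$, $\leq$, $>$) between entries, barred or not, are made by numerical value, so that $\bar k$ and $k$ have the same value $k$. A Legendre-Stirling permutation of $M_n$ is a permutation $\pi=\pi_1\pi_2\cdots\pi_{3n}$ of the multiset $M_n$ such that whenever $i<j<k$ and $\pi_i$ and $\pi_k$ are the two copies of the same unbarred element, then $\pi_j>\pi_i$ (in value, hence strictly). $L_n$ denotes the set of Legendre-Stirling permutations of $M_n$. For $\pi\in L_n$ set $\pi_0=\pi_{3n+1}=0$ and define subsets of $\{1,\ldots,3n\}$: $X(\pi)=\{i : \pi_{i-1}\leq\pi_i,\ \pi_i \text{ is unbarred and appears for the first time}\}$, $Y(\pi)=\{i : \pi_i>\pi_{i+1},\ \pi_i\text{ is unbarred}\}$, $Z(\pi)=\{i : \pi_{i-1}\leq\pi_i,\ \pi_i\text{ is unbarred and appears for the second time}\}$, $U(\pi)=\{i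 : \pi_{i-1}\leq\pi_i,\ \pi_i\text{ is barred}\}$, $V(\pi)=\{i : \pi_i>\pi_{i+1},\ \pi_i\text{ is barred}\}$. Here ''first/second time'' refers to reading $\pi$ from left to right. When $\pi_i=\bar k$, the variables $u_{\pi_i},v_{\pi_i}$ mean $u_k,v_k$. *)

(* Defs.v *)
From HB Require Import structures.
From mathcomp Require Import all_boot all_order all_algebra.
From mathcomp Require Import finmap monalg.

Set Implicit Arguments.
Unset Strict Implicit.
Unset Printing Implicit Defensive.

Import GRing.Theory.
Local Open Scope ring_scope.

(** * Letters and polynomials *)

(* [lX i] is the letter x_i, [lY i] is y_i, etc. *)
Inductive letter : Type :=
  | lX of nat | lY of nat | lZ of nat | lU of nat | lV of nat.

Definition letter_index (a : letter) : nat :=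
  match a with lX i | lY i | lZ i | lU i | lV i => i end.

Definition letter_code (a : letter) : nat * nat :=
  match a with
  | lX i => (0, i) | lY i => (1, i) | lZ i => (2, i) | lU i => (3, i)
  | lV i => (4, i)
  end%N.

Definition letter_decode (c : nat * nat) : letter :=
  match c with
  | (0, i) => lX i | (1, i) => lY i | (2, i) => lZ i | (3, i) => lU i
  | (_, i) => lV i
  end%N.

Lemma letter_codeK : cancel letter_code letter_decode.
Proof. by case. Qed.

Fact letter_eqP : Equality.axiom (fun a b => letter_code a == letter_code b).
Proof. by move=> a b; apply: (iffP eqP) => [/(can_inj letter_codeK)|->]. Qed.
HB.instance Definition _ := hasDecEq.Build letter letter_eqP.
HB.instance Definition _ : hasChoice letter := PCanHasChoice (can_pcan letter_codeK).

(* There are infinitely many letters, so polynomials are taken in the monoid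
   algebra of the free commutative monoid on [letter]. *)
Notation lpoly R := {malg R[{cmonom letter}]}.

Definition var (R : comNzRingType) (a : letter) : lpoly R := << 1 *g ucm a >>.

Definition x_ (R : comNzRingType) (i : nat) : lpoly R := var R (lX i).
Definition y_ (R : comNzRingType) (i : nat) : lpoly R := var R (lY i).
Definition z_ (R : comNzRingType) (i : nat) : lpoly R := var R (lZ i).
Definition u_ (R : comNzRingType) (i : nat) : lpoly R := var R (lU i).
Definition v_ (R : comNzRingType) (i : nat) : lpoly R := var R (lV i).

(** * Context-free grammars and their formal derivatives *)

(* [None] means that the letter has no production rule. *)
Definition grammar (R : comNzRingType) := letter -> option (lpoly R).

(* Nothing is required of [D] on the letters that have no rule. *)
Definition formal_derivative (R : comNzRingType) (G : grammar R)
    (D : {linear lpoly R -> lpoly R}) : Prop :=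
  (forall f g : lpoly R, D (f * g) = D f * g + f * D g) /\
  (forall (a : letter) (p : lpoly R), G a = Some p -> D (var R a) = p).

(* The grammar G_(2n-1). *)
Definition grammar_odd (R : comNzRingType) (n : nat) : grammar R :=
  fun a => if (letter_index a < n)%N then Some (u_ R n * v_ R n) else None.

(* The grammar G_(2n). *)
Definition grammar_even (R : comNzRingType) (n : nat) : grammar R :=
  fun a =>
    if (letter_index a < n)%N then Some (x_ R n * y_ R n * z_ R n)
    else if a == lU n then Some (x_ R n * z_ R n * u_ R n)
    else if a == lV n then Some (x_ R n * y_ R n * z_ R n)
    else None.

Lemma coefM1 (A : comNzRingType) (p q : {poly A}) :
  (p * q)`_1 = p`_1 * q`_0 + p`_0 * q`_1.
Proof. by rewrite coefM big_ord_recr big_ord1 /= addrC. Qed.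

Lemma coef1_affine (A : comNzRingType) (a b : A) : (a%:P + b%:P * 'X)`_1 = b.
Proof. by rewrite coefD coefC coefCM coefX /= add0r mulr1. Qed.

(* Every grammar has a formal derivative: the coefficient of 'X in the algebra
   morphism that maps each letter a to a + G(a) 'X (and to a if a has no
   rule). *)
Section Existence.
Variables (R : comNzRingType) (G : grammar R).

Let img (a : letter) : {poly lpoly R} :=
  (var R a)%:P + (odflt 0 (G a))%:P * 'X.

Let cst (c : R) : {poly lpoly R} := (malgC c)%:P.

Fact cst_zmod : zmod_morphism cst.
Proof. by move=> c d; rewrite /cst raddfB /= polyCB. Qed.
#[local] HB.instance Definition _ := GRing.isZmodMorphism.Build R {poly lpoly R} cst cst_zmod.
Fact cst_monoid : monoid_morphism cst.
Proof. by split=> [|c d]; rewrite /cst ?mpolyCM ?polyCM. Qed.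
#[local] HB.instance Definition _ := GRing.isMonoidMorphism.Build R {poly lpoly R} cst cst_monoid.

Let mon (m : {cmonom letter}) : {poly lpoly R} :=
  \prod_(a <- finsupp m) img a ^+ m a.

Lemma monEw (d : {fset letter}) (m : {cmonom letter}) :
  (finsupp m `<=` d)%fset -> mon m = \prod_(a <- d) img a ^+ m a.
Proof.
move=> le; rewrite /mon (big_fset_incl _ le) // => a _ Na.
by rewrite -[m a]/(cmonom_val m a) fsfun_dflt // expr0.
Qed.

Fact mon_mmorph : mmorphism mon.
Proof.
split=> [m1 m2|]; last by rewrite /mon mdom1 big_seq_fset0.
rewrite (monEw (d := finsupp m1 `|` finsupp m2)%fset) ?mdomD //.
rewrite (monEw (fsubsetUl (finsupp m1) (finsupp m2))).
rewrite (monEw (fsubsetUr (finsupp m1) (finsupp m2))).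
by rewrite -big_split; apply: eq_bigr => a _; rewrite cmM exprD.
Qed.
#[local] HB.instance Definition _ := isMultiplicative.Build {cmonom letter} {poly lpoly R} mon mon_mmorph.

Let phi (f : lpoly R) : {poly lpoly R} := mmap cst mon f.
Let D (f : lpoly R) : lpoly R := (phi f)`_1.

Lemma mon_U a : mon (ucm a) = img a.
Proof. by rewrite /mon mdomU big_seq_fset1 cmUU expr1. Qed.

Lemma mulmU (m1 m2 : {cmonom letter}) :
  << 1 *g m1 >> * << 1 *g m2 >> = << 1 *g mmul m1 m2 >> :> lpoly R.
Proof. by rewrite malgM_def fgmulUU mulr1. Qed.

Lemma oneU : 1 = << 1 *g mone >> :> lpoly R.
Proof. exact: erefl. Qed.

Lemma monomE (m : {cmonom letter}) :
  << 1 *g m >> = \prod_(a <- finsupp m) var R a ^+ m a :> lpoly R.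
Proof.
pose ex a k := iter k (mmul (ucm a)) (mone : {cmonom letter}).
have exE a k i : ex a k i = (k * (a == i))%N.
  by elim: k => [|k IH]; rewrite /ex /= ?cm1 // cmM ucmE -/(ex a k) IH mulSn.
have powE a k : var R a ^+ k = << 1 *g ex a k >>.
  elim: k => [|k IH]; first by rewrite expr0 oneU.
  have exS : ex a k.+1 = mmul (ucm a) (ex a k) by [].
  rewrite exS exprS IH /var mulmU; reflexivity.
have prodE (d : seq letter) : \prod_(a <- d) var R a ^+ m a
    = << 1 *g \big[mmul/mone]_(a <- d) ex a (m a) >>.
  elim: d => [|a d IH]; first by rewrite !big_nil oneU.
  rewrite !big_cons IH powE mulmU; reflexivity.
rewrite prodE; congr (<< 1 *g _ >>); apply/eqP/cmP => i.
have bigE (d : seq letter) : (\big[mmul/mone]_(a <- d) ex a (m a)) i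
    = (\sum_(a <- d) m a * (a == i))%N.
  elim: d => [|a d IH]; first by rewrite !big_nil cm1.
  by rewrite !big_cons cmM IH exE.
rewrite bigE; case: (mdomP m i) => [|] Hi.
  rewrite (big_fsetD1 i) //= eqxx muln1 big_seq big1 ?addn0 // => a.
  by rewrite !inE => /andP[/negPf-> _]; rewrite muln0.
rewrite big_seq big1 // => a Ha; case: eqP => [ai|]; last by rewrite muln0.
by rewrite -ai Ha in Hi.
Qed.

Lemma mon0 m : (mon m)`_0 = << 1 *g m >>.
Proof.
rewrite monomE /mon -horner_coef0 horner_prod; apply: eq_bigr => a _.
by rewrite horner_exp /img !hornerE.
Qed.

Lemma phi0 f : (phi f)`_0 = f.
Proof.
rewrite /phi mmapE coef_sum [RHS]monalgE; apply: eq_bigr => m _.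
rewrite /cst coefCM mon0 mul_malgC; apply/malgP => k.
rewrite mcoeffZ; move: (f@_m) => c.
transitivity (c *+ (m == k)); last by rewrite -mcoeffU.
by transitivity (c * (1 *+ (m == k))); [congr (_ * _); exact: mcoeffU | rewrite mulr_natr].
Qed.

Fact D_linear : linear D.
Proof.
move=> c f g; rewrite /D /phi raddfD /= mmapZ coefD /cst coefCM mul_malgC //.
Qed.
#[local] HB.instance Definition _ := GRing.isLinear.Build R (lpoly R) (lpoly R) _ D D_linear.

Lemma formal_derivative_exists : exists D, formal_derivative G D.
Proof.
exists D; split=> [f g|a p Ga].
  have phiM : phi (f * g) = phi f * phi g by apply: rmorphM.
  change ((phi (f * g))`_1 = (phi f)`_1 * g + f * (phi g)`_1).
  have := coefM1 (phi f) (phi g); have := phi0 f; have := phi0 g.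
  by move: (phi f) (phi g) (phi (f * g)) phiM => pf pg pfg -> -> ->.
have phiU : phi (var R a) = img a.
  have cst1 : cst 1 = 1 by case: cst_monoid.
  rewrite /phi /var mmapU mon_U; transitivity (1 * img a); last exact: mul1r.
  congr (_ * _); exact: cst1.
change ((phi (var R a))`_1 = p).
rewrite phiU /img Ga; exact: coef1_affine.
Qed.
End Existence.

(** * Legendre-Stirling permutations *)

(* An entry is its numerical value together with a bar flag: [(k, false)] is k
   and [(k, true)] is k-bar. *)
Definition entry : eqType := (nat * bool)%type.
Definition value (e : entry) : nat := e.1.
Definition barred (e : entry) : bool := e.2.

(* The multiset {1, 1, 1-bar, ..., n, n, n-bar}, listed. *)
Definition LS_multiset (n : nat) : seq entry :=
  flatten [seq [:: (k, false); (k, false); (k, true)] | k <- iota 1 n].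

(* [at_ p i] is the entry pi_i, with positions numbered from 1; the default
   value of [nth] gives pi_0 = pi_(3n+1) = 0. *)
Definition at_ (p : seq entry) (i : nat) : entry :=
  nth (0%N, false) ((0%N, false) :: p) i.

Definition is_LS (p : seq entry) : bool :=
  [forall i : 'I_(size p).+1, forall j : 'I_(size p).+1,
   forall k : 'I_(size p).+1,
     [&& 0 < i, i < j, j < k, ~~ barred (at_ p i) & at_ p i == at_ p k]%N
       ==> (value (at_ p i) < value (at_ p j))%N].

(* [permutations s] lists each rearrangement of [s] exactly once, even when [s]
   has repeated items. *)
Definition LS_perms (n : nat) : seq (seq entry) := [seq p <- permutations (LS_multiset n) | is_LS p].

(* The number of occurrences of pi_i among pi_1, ..., pi_(i-1). *)
Definition earlier (p : seq entry) (i : nat) : nat :=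
  count_mem (at_ p i) (take i.-1 p).

Definition weak_ascent (p : seq entry) (i : nat) : bool :=
  (value (at_ p i.-1) <= value (at_ p i))%N.
Definition descent (p : seq entry) (i : nat) : bool :=
  (value (at_ p i.+1) < value (at_ p i))%N.

(* Membership of a position i >= 1 in X(pi), Y(pi), Z(pi), U(pi), V(pi). *)
Definition inX (p : seq entry) (i : nat) : bool :=
  [&& weak_ascent p i, ~~ barred (at_ p i) & earlier p i == 0%N].
Definition inY (p : seq entry) (i : nat) : bool :=
  descent p i && ~~ barred (at_ p i).
Definition inZ (p : seq entry) (i : nat) : bool :=
  [&& weak_ascent p i, ~~ barred (at_ p i) & earlier p i == 1%N].
Definition inU (p : seq entry) (i : nat) : bool :=
  weak_ascent p i && barred (at_ p i).
Definition inV (p : seq entry) (i : nat) : bool :=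
  descent p i && barred (at_ p i).

Definition LS_poly (R : comNzRingType) (n : nat) : lpoly R :=
  \sum_(p <- LS_perms n)
    ((\prod_(1 <= i < (3 * n).+1 | inX p i) x_ R (value (at_ p i))) *
     (\prod_(1 <= i < (3 * n).+1 | inY p i) y_ R (value (at_ p i))) *
     (\prod_(1 <= i < (3 * n).+1 | inZ p i) z_ R (value (at_ p i))) *
     (\prod_(1 <= i < (3 * n).+1 | inU p i) u_ R (value (at_ p i))) *
     (\prod_(1 <= i < (3 * n).+1 | inV p i) v_ R (value (at_ p i)))).

(* Main.v *)
(* Each of the 3n+1 gaps of a Legendre-Stirling permutation of M_n gets one
   letter: a descent is charged to its left entry (y or v), a weak ascent to its
   right entry (x, z or u).  The product of the gap labels is the monomial of the
   permutation.  Removing the bar entry and the two (necessarily adjacent) plain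
   copies of the maximal value m inverts the insertion of m-bar into an arbitrary
   gap followed by the insertion of m m into an arbitrary gap.  Inserting m-bar
   replaces the label of the gap by u_m v_m; inserting m m replaces it by
   x_m y_m z_m, except for a gap just before m-bar, whose label u_m becomes
   x_m z_m u_m.  By the Leibniz rule these are the actions of D_(2m-1) and D_(2m). *)
Require Import Defs.
From mathcomp Require Import all_boot all_order all_algebra.
From mathcomp Require Import finmap monalg zify.

Set Implicit Arguments.
Unset Strict Implicit.
Unset Printing Implicit Defensive.

Import GRing.Theory.
Local Open Scope ring_scope.

(** * Inserting a block into a word *)

Fixpoint inserts (T : Type) (w p : seq T) : seq (seq T) :=
  (w ++ p) :: (if p is b :: p' then [seq b :: q | q <- inserts w p'] else [::]).

Section Inserts.
Variable T : eqType.
Implicit Types (e : T) (w p q : seq T).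

Lemma mem_inserts w p q :
  reflect (exists p1 p2, p = p1 ++ p2 /\ q = p1 ++ w ++ p2) (q \in inserts w p).
Proof.
elim: p q => [|b p IH] q /=; rewrite inE.
  rewrite cats0; apply: (iffP eqP) => [->|].
    by exists [::], [::]; rewrite /= cats0.
  by move=> [[|c p1] [[|d p2] []]] //= _; rewrite cats0.
apply: (iffP orP) => [[/eqP->|/mapP[r /IH[p1 [p2 [-> ->]]] ->]]|].
- by exists [::], (b :: p).
- by exists (b :: p1), p2.
move=> [[|c p1] [p2 [/= Ep ->]]]; first by rewrite -Ep; left.
case: Ep => <- Ep; right; apply/mapP; exists (p1 ++ w ++ p2) => //.
by apply/IH; exists p1, p2.
Qed.

Lemma perm_inserts w p q : q \in inserts w p -> perm_eq q (w ++ p).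
Proof. by move=> /mem_inserts[p1 [p2 [-> ->]]]; rewrite perm_catCA. Qed.

Lemma filter_inserts e k p q : e \notin p -> q \in inserts (nseq k e) p ->
  filter (predC1 e) q = p.
Proof.
move=> ep /mem_inserts[p1 [p2 [Ep ->]]]; rewrite !filter_cat filter_nseq /=.
by rewrite eqxx /= -filter_cat -Ep; apply/all_filterP/allP => x /=; apply: contraTneq => ->.
Qed.

(** The first [e] of the result marks the gap that was used, so distinct gaps give distinct
    words. *)
Lemma uniq_inserts e k p : (0 < k)%N -> e \notin p -> uniq (inserts (nseq k e) p).
Proof.
case: k => // k _; elim: p => [|b p IH] //=; rewrite inE negb_or => /andP[eb ep].
rewrite map_inj_uniq ?IH ?andbT //; last by move=> ? ? [].
by apply/mapP => -[r _ [Eb]]; rewrite Eb eqxx in eb.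
Qed.

(** Both lists are duplicate-free with the same members: erasing [e] recovers [p] from any of its
    insertions, so different words [p] never share one. *)
Lemma perm_filter_permutations (P : pred (seq T)) e k s t :
  (0 < k)%N -> e \notin s -> perm_eq t (nseq k e ++ s) ->
  (forall p q, perm_eq p s -> q \in inserts (nseq k e) p -> P q = P p) ->
  (forall q, perm_eq q t -> P q -> exists p, q \in inserts (nseq k e) p) ->
  perm_eq (filter P (permutations t))
    [seq q | p <- filter P (permutations s), q <- inserts (nseq k e) p].
Proof.
move=> k0 es Et HP Hins.
have Nes p : p \in filter P (permutations s) -> e \notin p.
  by rewrite mem_filter mem_permutations => /andP[_ /perm_mem->].
apply: uniq_perm.
- exact/filter_uniq/permutations_uniq.
- apply: allpairs_uniq_dep.
  + exact/filter_uniq/permutations_uniq.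
  + by move=> p /Nes; apply: uniq_inserts.
  move=> _ _ /allpairsPdep[p [q [sp pq ->]]] /allpairsPdep[p' [q' [sp' pq' ->]]] /= Eq.
  move: pq'; rewrite -{q'}Eq => pq'.
  by rewrite -(filter_inserts (Nes _ sp) pq) -(filter_inserts (Nes _ sp') pq').
move=> q; rewrite mem_filter mem_permutations; apply/andP/allpairsPdep.
  move=> [Pq qt]; have [p pq] := Hins q qt Pq; exists p, q; split=> //.
  have ps : perm_eq p s.
    rewrite -(perm_cat2l (nseq k e)); apply: perm_trans (perm_trans qt Et).
    by rewrite perm_sym perm_inserts.
  by rewrite mem_filter mem_permutations ps andbT -(HP p q).
move=> [p [q1 []]]; rewrite mem_filter mem_permutations => /andP[Pp ps] pq ->.
rewrite (HP p q1) //; split=> //; rewrite (perm_trans (perm_inserts pq)) //.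
by rewrite perm_sym (perm_trans Et) // perm_cat2l perm_sym.
Qed.

Lemma subseq_cons_cat_notin e s p q : e \notin p ->
  subseq (e :: s) (p ++ q) = subseq (e :: s) q.
Proof.
by elim: p => //= b p IH; rewrite inE negb_or => /andP[/negPf-> /IH].
Qed.

Lemma subseq_consP e s p :
  reflect (exists p1 p2, p = p1 ++ e :: p2 /\ subseq s p2) (subseq (e :: s) p).
Proof.
apply: (iffP idP) => [|[p1 [p2 [-> sp2]]]]; last first.
  by rewrite -[e :: s]cat0s cat_subseq ?sub0seq //= eqxx.
elim: p => //= b p IH; case: eqP => [-> sp|_ /IH[p1 [p2 [-> sp2]]]].
  by exists [::], p.
by exists (b :: p1), p2.
Qed.

Lemma subseq_map_nth x0 p (m : seq nat) :
  sorted ltn m -> all (gtn (size p)) m -> subseq [seq nth x0 p i | i <- m] p.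
Proof.
move=> sm am; rewrite -[X in subseq _ X](mkseq_nth x0 p) /mkseq; apply: map_subseq.
suff -> : m = filter (mem m) (iota 0 (size p)) by apply: filter_subseq.
apply: (irr_sorted_eq ltn_trans ltnn sm) => [|i].
  exact/(sorted_filter ltn_trans)/iota_ltn_sorted.
rewrite mem_filter mem_iota /= add0n; case im: (i \in m) => //=.
by have := allP am i im.
Qed.

End Inserts.

(** * The Legendre-Stirling condition as a forbidden pattern *)

Lemma is_LSP (p : seq entry) :
  reflect (forall e f, ~~ barred e -> subseq [:: e; f; e] p -> (value e < value f)%N)
    (is_LS p).
Proof.
apply: (iffP idP) => [LS e f be|H].
  case/subseq_consP=> p1 [q1 [Ep /subseq_consP[p2 [q2 [Eq1 /subseq_consP[p3 [p4 [Eq2 _]]]]]]]].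
  rewrite {}Eq1 {}Eq2 in Ep.
  (* Positions count from 1, so the entry right after the prefix [p1] has position
     [(size p1).+1]. *)
  pose i := (size p1).+1; pose j := (i + (size p2).+1)%N; pose k := (j + (size p3).+1)%N.
  have ai : at_ p i = e by rewrite /at_ Ep /= nth_cat ltnn subnn.
  have aj : at_ p j = f.
    by rewrite /at_ Ep /j /i addSn /= -nth_drop drop_size_cat //= nth_cat ltnn subnn.
  have ak : at_ p k = e.
    rewrite /at_ Ep /k /j /i !addSn /= -addnA -nth_drop drop_size_cat //=.
    by rewrite -nth_drop drop_size_cat //= nth_cat ltnn subnn.
  have kp : (k < (size p).+1)%N.
    by rewrite Ep /k /j /i size_cat /= size_cat /= size_cat /=; lia.
  have ij : (i < j)%N by rewrite /j addnS ltnS leq_addr.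
  have jk : (j < k)%N by rewrite /k addnS ltnS leq_addr.
  have jp := ltn_trans jk kp; have ip := ltn_trans ij jp.
  move/forallP/(_ (Ordinal ip))/forallP/(_ (Ordinal jp))/forallP/(_ (Ordinal kp)): LS.
  by move/implyP; rewrite /= ai aj ak be ij jk eqxx; apply.
apply/forallP => -[i ip]; apply/forallP => -[j jp]; apply/forallP => -[k kp].
apply/implyP => /= /and5P[i0 ij jk be /eqP eik]; apply: H => //.
case: i ip i0 ij be eik => // i _ _; case: j jp jk => // j _; case: k kp => // k.
rewrite !ltnS /at_ /= => kp jk ij _ {2}->.
apply: (subseq_map_nth _ (m := [:: i; j; k])); first by rewrite /= ij jk.
by rewrite /= kp (ltn_trans jk kp) (ltn_trans ij (ltn_trans jk kp)).
Qed.

(** * Gap labels and their products *)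

Definition zero_entry : entry := (0%N, false).

(* The label of the gap between the last entry of [s] (0 if [s] is empty) and
   the entry [b] that follows it; a value 0 closes the word. *)
Definition label (s : seq entry) (b : entry) : letter :=
  let a := last zero_entry s in
  if (value b < value a)%N then (if barred a then lV else lY) (value a)
  else (if barred b then lU else if b \in s then lZ else lX) (value b).

Section Weight.
Variables (A : comNzRingType) (h : letter -> A).

(* [weight s q] multiplies the labels of the gaps that end at an entry of [q],
   in the word [s ++ q]. *)
Fixpoint weight (s q : seq entry) : A :=
  if q is b :: q' then h (label s b) * weight (rcons s b) q' else 1.

Lemma weight_cat s p q : weight s (p ++ q) = weight s p * weight (s ++ p) q.
Proof.
elim: p s => [|b p IH] s /=; first by rewrite mul1r cats0.
by rewrite IH mulrA cat_rcons.
Qed.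

(** A label sees its prefix only through the last entry and through whether the next entry has
    already occurred, which decides between x and z. *)
Lemma eq_weight s s' q : last zero_entry s = last zero_entry s' ->
  {in q, s =i s'} -> weight s q = weight s' q.
Proof.
elim: q s s' => [//|b q IH] s s' El Es /=.
have -> : label s b = label s' b by rewrite /label El Es ?mem_head.
rewrite (IH _ (rcons s' b)) ?last_rcons // => c qc.
by rewrite !mem_rcons !inE Es // inE qc orbT.
Qed.

Lemma weightE s q :
  weight s q = \prod_(0 <= i < size q) h (label (s ++ take i q) (nth zero_entry q i)).
Proof.
elim: q s => [|b q IH] s; first by rewrite big_geq.
rewrite /= big_nat_recl // IH /= cats0; congr (_ * _).
by apply: eq_bigr => i _; rewrite -cat_rcons.
Qed.

(** The Leibniz rule differentiates one gap label at a time, and each term is the insertion of [w]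
    into that gap. The predicate [P] separates the entries of the word from those of [w], which
    keeps all other labels unchanged. *)
Lemma derive_weight (D : A -> A) (P : pred entry) w s q :
  (forall f g, D (f * g) = D f * g + f * D g) ->
  {in w, forall e, ~~ P e} -> P zero_entry ->
  (forall s b, all P s -> P b -> D (h (label s b)) = weight s (rcons w b)) ->
  all P s -> all P q ->
  D (weight s (rcons q zero_entry)) =
    \sum_(q' <- inserts w q) weight s (rcons q' zero_entry).
Proof.
move=> DM Pw P0 Dlab; have D1 : D 1 = 0.
  by have /eqP := DM 1 1; rewrite !mulr1 mul1r -subr_eq subrr eq_sym => /eqP.
elim: q s => [|b q IH] s Ps /=.
  by move=> _; rewrite DM D1 mulr0 addr0 big_seq1 mulr1 cats0; apply: Dlab.
move=> /andP[Pb Pq]; rewrite DM big_cons big_map IH ?all_rcons ?Pb // Dlab //.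
rewrite mulr_sumr; congr (_ + _).
rewrite -cat_rcons rcons_cat weight_cat; congr (_ * _).
(* Past [b], the prefixes with and without [w] end alike and differ only by entries of [w]; these
   fail [P], so they do not recur. *)
apply: eq_weight => [|c]; first by rewrite -rcons_cat !last_rcons.
rewrite mem_rcons inE => cq; have Pc : P c.
  by case/predU1P: cq => [-> //|]; apply: (allP Pq).
rewrite mem_cat !mem_rcons !inE; case: (c == b); rewrite /= ?orbT //.
case wc: (c \in w); last by rewrite orbF.
by have := Pw c wc; rewrite Pc.
Qed.

End Weight.

(* The entries of a word into which [m m] is still to be inserted. *)
Definition lower_entry (m : nat) (e : entry) : bool :=
  (value e <= m)%N && (e != (m, false)).

(** * Labels around an inserted block *)

Section Steps.
Variables (A : comNzRingType) (h : letter -> A) (m : nat).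
Hypothesis m_gt0 : (0 < m)%N.
Implicit Types (s : seq entry) (b : entry).

Lemma last_all (P : pred entry) s : all P s -> P zero_entry -> P (last zero_entry s).
Proof.
move=> Ps P0; have := mem_last zero_entry s; rewrite inE.
by case/predU1P => [->|/(allP Ps)].
Qed.

Lemma label_index_lt s b :
  all (fun e => value e < m)%N s -> (value b < m)%N ->
  (letter_index (label s b) < m)%N.
Proof.
move=> /last_all Ps bm; have {Ps} := Ps m_gt0; rewrite /label.
move: (last _ s) => a am.
by case: ifP => _; do ?case: ifP => _ /=; rewrite ?am ?bm.
Qed.

Lemma weight_insert_barred s b :
  all (fun e => value e < m)%N s -> (value b < m)%N ->
  weight h s [:: (m, true); b] = h (lU m) * h (lV m).
Proof.
move=> /last_all Ps bm; have {Ps} am := Ps m_gt0.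
rewrite /= mulr1 /label last_rcons /= bm.
by rewrite ltnNge (ltnW am).
Qed.

Lemma lower_entry0 : lower_entry m zero_entry.
Proof. by rewrite /lower_entry /= xpair_eqE andbT neq_ltn m_gt0. Qed.

(** The only entry of value [m] in such a word is m-bar, so a label of index [m] is u_m or v_m.
    Hence G_(2m) has a rule for every label. *)
Lemma label_lower s b :
  all (lower_entry m) s -> lower_entry m b ->
  [|| letter_index (label s b) < m, label s b == lU m | label s b == lV m]%N.
Proof.
move=> /last_all Ps; have {Ps} := Ps lower_entry0; rewrite /label.
move: (last _ s) => [av ab]; case: b => [bv bb].
rewrite /lower_entry /value /barred /= !xpair_eqE (leq_eqVlt av) (leq_eqVlt bv).
move=> /andP[/predU1P[->|am] an] /andP[/predU1P[->|bm] bn];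
  case: ab an => //; case: bb bn => //; rewrite ?ltnn ?eqxx //= => _ _;
  do ?case: ifP => ? /=; rewrite ?am ?bm ?eqxx ?orbT //; lia.
Qed.

(** The gaps ending at the two copies of [m] are weak ascents labelled x_m and z_m. The gap before
    [b] is a descent, labelled y_m, unless [b] is m-bar, which happens exactly when the old label
    was u_m. *)
Lemma weight_insert_pair s b :
  all (lower_entry m) s -> lower_entry m b ->
  weight h s [:: (m, false); (m, false); b] =
    if label s b == lU m then h (lX m) * h (lZ m) * h (lU m)
    else h (lX m) * h (lY m) * h (lZ m).
Proof.
(* Both branches share the factor x_m z_m; only the label of the gap before [b] depends on the
   case. *)
rewrite [h (lX m) * h (lY m) * _]mulrAC -(fun_if ( *%R (h (lX m) * h (lZ m)))).
move=> Ps.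
have ms : (m, false) \notin s.
  by apply/negP => /(allP Ps); rewrite /lower_entry eqxx andbF.
have {Ps} := last_all Ps lower_entry0.
rewrite /= mulr1 /label !last_rcons mem_rcons mem_head (negPf ms) mulrA.
move: (last _ s) => [av ab]; case: b => [bv bb].
rewrite /lower_entry /value /barred /= ltnn !xpair_eqE.
move=> /andP[am an] /andP[bm bn]; rewrite (ltnNge m av) am /=; congr (_ * _).
case: ltnP => bm'.
  case: eqP => // El; have := congr1 letter_index El.
  by case: ltnP El => [_|_ _]; [case: ab an | do ?case: ifP => _ /=; lia].
have {bm bm'} Eb : bv = m by apply/eqP; rewrite eqn_leq bm.
move: bn; rewrite Eb eqxx ltnNge am; case: bb => //= _.
by rewrite eqxx.
Qed.
End Steps.

(** * Insertion and the Legendre-Stirling condition *)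

(** A pattern [e f e] of [q] that avoids [c] lies in [p]. If only [f] is [c], then [e] is an
    unbarred entry of [p], hence below [m]. Finally [c] cannot play [e], since its at most two
    copies are adjacent. *)
Lemma is_LS_inserts m c k p q : (k <= 2)%N -> value c = m ->
  c \notin p -> all (lower_entry m) p ->
  q \in inserts (nseq k c) p -> is_LS q = is_LS p.
Proof.
move=> k2 cm cp lp qp; apply/is_LSP/is_LSP => H e f be sub.
  apply: H => //; apply: subseq_trans sub _.
  by rewrite -(filter_inserts cp qp) filter_subseq.
have Ep := filter_inserts cp qp.
have [Ee|ec] := eqVneq e c; last first.
  have [Ef|fc] := eqVneq f c; last first.
    by apply: H => //; rewrite -Ep subseq_filter /= ec fc.
  have: e \in p by rewrite -Ep mem_filter /= ec (mem_subseq sub) ?mem_head.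
  move=> /(allP lp) /andP[le ne]; rewrite Ef cm ltn_neqAle le andbT.
  by apply: contra ne => /eqP; case: e be {le sub ec} => v [] //= _ ->.
rewrite {}Ee in be sub; exfalso.
have cq : (count_mem c q <= 2)%N.
  rewrite (permP (perm_inserts qp)) count_cat count_nseq /= eqxx mul1n.
  by rewrite (count_memPn cp) addn0.
have [Ef|fc] := eqVneq f c.
  by have := leq_trans (leq_count_subseq (pred1 c) sub) cq; rewrite Ef /= eqxx.
have [p1 [p2 [Ep12 Eq]]] := mem_inserts _ _ _ qp.
move: cp sub; rewrite Ep12 Eq mem_cat negb_or => /andP[cp1 cp2].
rewrite subseq_cons_cat_notin //.
have N2 r : c \in r -> subseq r p2 -> False.
  by move=> cr /mem_subseq/(_ c cr); rewrite (negPf cp2).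
(* Since [p1] lacks [c], matching starts at the block; for each [k], a part of the pattern that
   contains [c] would have to fit inside [p2]. *)
case: k k2 {qp Ep Eq cq} => [|[|[|]]] // _; rewrite /= ?eqxx ?(negPf fc).
- by move=> sub; apply: (N2 [:: c; f; c]); rewrite ?mem_head.
- by apply: N2; rewrite !inE eqxx orbT.
- by apply: N2; rewrite !inE eqxx orbT.
Qed.

(** An entry between the two copies of [m] would have to exceed [m], the largest value present. *)
Lemma is_LS_pair m s q : all (lower_entry m) s ->
  perm_eq q (nseq 2 (m, false) ++ s) -> is_LS q ->
  exists p, q \in inserts (nseq 2 (m, false)) p.
Proof.
move=> ls qs /is_LSP LS; set c := (m, false) in qs *.
have cs : c \notin s by apply/negP => /(allP ls); rewrite /lower_entry eqxx andbF.
have cq : count_mem c q = 2%N.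
  by rewrite (permP qs) count_cat count_nseq /= eqxx (count_memPn cs).
have: subseq [:: c; c] q.
  rewrite -[[:: c; c]]/(nseq 2 c) -cq -size_filter.
  have /all_pred1P <- : all (pred1 c) (filter (pred1 c) q) by apply: filter_all.
  exact: filter_subseq.
case/subseq_consP=> q1 [r [Eq /subseq_consP[q2 [q3 [Er _]]]]].
rewrite {}Er in Eq; case: q2 => [|f q2] in Eq.
  by exists (q1 ++ q3); apply/mem_inserts; exists q1, q3.
have fm : (value f <= m)%N.
  have: f \in q by rewrite Eq mem_cat !inE eqxx !orbT.
  by rewrite (perm_mem qs) mem_cat mem_nseq => /orP[/eqP->|/(allP ls)/andP[]].
have: (value c < value f)%N.
  apply: LS => //; apply/subseq_consP; exists q1, ((f :: q2) ++ c :: q3).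
  by split=> //=; rewrite eqxx sub1seq mem_cat mem_head orbT.
by rewrite ltnNge fm.
Qed.

(** * Values and multiplicities in M_n *)

Lemma LS_multisetS n : perm_eq (LS_multiset n.+1)
  (nseq 2 (n.+1, false) ++ (n.+1, true) :: LS_multiset n).
Proof.
rewrite /LS_multiset -{1}[n.+1]addn1 iotaD map_cat flatten_cat perm_catC /= add1n.
by [].
Qed.

Lemma LS_multiset_value n e : e \in LS_multiset n -> (0 < value e <= n)%N.
Proof.
move=> /flattenP[_ /mapP[k kn ->]]; move: kn; rewrite mem_iota add1n ltnS => kn.
by rewrite !inE => /or3P[] /eqP->.
Qed.

Lemma count_LS_multiset n (e : entry) : (count_mem e (LS_multiset n) <= 2)%N.
Proof.
elim: n => // n IH; rewrite (permP (LS_multisetS n)) /=.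
have [en|en] := leqP (value e) n.
  have ne b : (n.+1, b) == e = false.
    by apply/negP => /eqP Ee; rewrite -Ee /= ltnn in en.
  by rewrite !ne.
rewrite (count_memPn _) ?addn0; last first.
  by apply/negP => /LS_multiset_value; rewrite [(value e <= n)%N]leqNgt en andbF.
case: e en {IH} => v b _; rewrite !xpair_eqE; case: (n.+1 == v) => //.
by case: b.
Qed.

(** * From gap labels to the monomial of a permutation *)

Section Monomial.
Variables (A : comNzRingType) (h : letter -> A) (p : seq entry).
Hypothesis p_nil : p != [::].
Hypothesis p_gt0 : {in p, forall e, 0 < value e}%N.
Hypothesis p_count : forall e, (count_mem e p <= 2)%N.

(** What entry i contributes through the gap on its left ([asc]) and on its right ([des]); the value
    is 1 when that gap is charged to the other neighbour. *)
Let asc i := if weak_ascent p i then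
  h ((if barred (at_ p i) then lU else if at_ p i \in take i.-1 p then lZ else lX)
    (value (at_ p i))) else 1.
Let des i := if descent p i then
  h ((if barred (at_ p i) then lV else lY) (value (at_ p i))) else 1.

(** Gap i, between positions i and i+1, contributes [asc i.+1 * des i]; shifting the first factor
    regroups the product by entries. *)
Lemma weight_prod_gaps : weight h [::] (rcons p zero_entry) =
  \prod_(1 <= i < (size p).+1) (asc i * des i).
Proof.
have E i : (i < (size p).+1)%N ->
    h (label ([::] ++ take i (rcons p zero_entry)) (nth zero_entry (rcons p zero_entry) i))
    = asc i.+1 * des i.
  rewrite ltnS => ip; rewrite -cats1 takel_cat // cats1 /asc /des /label.
  rewrite (last_nth zero_entry) size_takel //.
  have -> : nth zero_entry (zero_entry :: take i p) i = at_ p i.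
    by case: i ip => //= i ip; rewrite nth_take.
  have -> : nth zero_entry (rcons p zero_entry) i = at_ p i.+1.
    (* The appended [zero_entry] agrees with the default value of [nth]. *)
    rewrite nth_rcons /at_ /=; case: ltnP => // pi; rewrite nth_default //.
    by case: ifP.
  rewrite /weak_ascent /descent /= [(value (at_ p i) <= _)%N]leqNgt.
  by case: (_ < _)%N; rewrite ?mulr1 ?mul1r.
rewrite weightE size_rcons (eq_big_nat _ _ (F2 := fun i => asc i.+1 * des i)); last first.
  by move=> i /andP[_]; apply: E.
rewrite !big_split /= big_nat_recr //= [X in _ * X]big_nat_recl //=.
(* The two boundary factors are trivial: nothing descends from the initial 0, and the last gap is a
   strict descent because entries are positive. *)
rewrite [des 0%N]/des /descent ltn0 mul1r.
rewrite [asc _.+1]/asc /weak_ascent [at_ p _.+1]/at_ /= nth_default //.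
have p0 : (0 < value (at_ p (size p)))%N.
  apply: p_gt0; case: p p_nil => // b r _.
  exact: (@mem_nth _ zero_entry (b :: r) (size r) (leqnn _)).
by rewrite leqNgt p0 mulr1 !big_add1.
Qed.

Lemma weight_LS : weight h [::] (rcons p zero_entry) =
  (\prod_(1 <= i < (size p).+1 | inX p i) h (lX (value (at_ p i)))) *
  (\prod_(1 <= i < (size p).+1 | inY p i) h (lY (value (at_ p i)))) *
  (\prod_(1 <= i < (size p).+1 | inZ p i) h (lZ (value (at_ p i)))) *
  (\prod_(1 <= i < (size p).+1 | inU p i) h (lU (value (at_ p i)))) *
  (\prod_(1 <= i < (size p).+1 | inV p i) h (lV (value (at_ p i)))).
Proof.
rewrite weight_prod_gaps.
rewrite (big_mkcond (inX p)) (big_mkcond (inY p)) (big_mkcond (inZ p)).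
rewrite (big_mkcond (inU p)) (big_mkcond (inV p)) -!big_split /=.
apply: eq_big_nat => -[//|i] /andP[_]; rewrite ltnS => ip.
(* The current entry is itself one of at most two copies, so [earlier] is 0 or 1 and occurring in
   the prefix means exactly 1. *)
have: (count_mem (at_ p i.+1) (take i p) < 2)%N.
  apply: leq_trans (p_count (at_ p i.+1)).
  have -> : count_mem (at_ p i.+1) p =
      (count_mem (at_ p i.+1) (take i p) + count_mem (at_ p i.+1) (drop i p))%N.
    by rewrite -count_cat cat_take_drop.
  rewrite (drop_nth zero_entry ip) /=.
  by rewrite eqxx addnCA leq_addr.
rewrite /inX /inY /inZ /inU /inV /asc /des /earlier /= -has_pred1 has_count.
case: (weak_ascent _ _); case: (descent _ _); case: (barred _);
  case: (count_mem _ _) => [|[|]] //= _; rewrite ?(mulr1, mul1r) //.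
exact: mulrC.
Qed.

End Monomial.

Lemma LS_poly_weight (R : comNzRingType) n : (0 < n)%N ->
  LS_poly R n = \sum_(p <- LS_perms n) weight (var R) [::] (rcons p zero_entry).
Proof.
move=> n0; rewrite /LS_poly; apply: eq_big_seq => p.
rewrite mem_filter mem_permutations => /andP[_ pn].
have sp : size p = (3 * n)%N.
  rewrite (perm_size pn); elim: {p pn n0} n => // n IH.
  by rewrite (perm_size (LS_multisetS n)) /= IH mulnS.
have p0 : p != [::] by rewrite -size_eq0 sp muln_eq0 /= -lt0n.
have pgt : {in p, forall e, 0 < value e}%N.
  by move=> e; rewrite (perm_mem pn) => /LS_multiset_value/andP[].
have pc e : (count_mem e p <= 2)%N by rewrite (permP pn) count_LS_multiset.
rewrite -sp [RHS](weight_LS (var R) p0 pgt pc); reflexivity.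
Qed.

(** * Generating L_(n+1) from L_n *)

Lemma LS_perms_entries n p : p \in LS_perms n -> all (fun e => value e < n.+1)%N p.
Proof.
rewrite mem_filter mem_permutations => /andP[_ pn]; rewrite (perm_all _ pn).
by apply/allP => e /LS_multiset_value/andP[].
Qed.

Lemma LS_perms_barred_entries n p q : p \in LS_perms n ->
  q \in inserts [:: (n.+1, true)] p -> all (lower_entry n.+1) q.
Proof.
move=> /LS_perms_entries lp /perm_inserts qp; rewrite (perm_all _ qp) /=.
rewrite /lower_entry leqnn xpair_eqE andbF /=; apply: sub_all lp => e en.
by rewrite (ltnW en); apply: contraTneq en => ->; rewrite ltnn.
Qed.

(** The intermediate words rearrange M_n together with one barred n+1. Inserting that barred entry
    anywhere preserves [is_LS], and the two plain copies of n+1 are necessarily adjacent, so they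
    enter as one block. *)
Lemma perm_LS_perms n : perm_eq (LS_perms n.+1)
  [seq r | q <- [seq q | p <- LS_perms n, q <- inserts [:: (n.+1, true)] p],
           r <- inserts [:: (n.+1, false); (n.+1, false)] q].
Proof.
set c := (n.+1, false); set d := (n.+1, true); set s := LS_multiset n.
have ls : all (lower_entry n.+1) s.
  apply/allP => e /LS_multiset_value/andP[_ en].
  rewrite /lower_entry (leqW en); apply: contraTneq en => ->; by rewrite ltnn.
have ds : d \notin s by apply/negP => /LS_multiset_value; rewrite ltnn andbF.
have lds : all (lower_entry n.+1) (d :: s) by rewrite /= ls andbT /lower_entry leqnn xpair_eqE andbF.
have cds : c \notin d :: s.
  by apply/negP => /(allP lds); rewrite /lower_entry eqxx andbF.
have step1 : perm_eq (filter is_LS (permutations (d :: s)))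
    [seq q | p <- LS_perms n, q <- inserts [:: d] p].
  apply: (@perm_filter_permutations _ _ d 1) => // [p q ps|q qs _].
    apply: (is_LS_inserts (m := n.+1)) => //; first by rewrite (perm_mem ps).
    by rewrite (perm_all _ ps).
  have: d \in q by rewrite (perm_mem qs) mem_head.
  rewrite -sub1seq => /subseq_consP[q1 [q2 [Eq _]]].
  by exists (q1 ++ q2); apply/mem_inserts; exists q1, q2.
have step2 : perm_eq (LS_perms n.+1)
    [seq r | q <- filter is_LS (permutations (d :: s)), r <- inserts [:: c; c] q].
  apply: (@perm_filter_permutations _ _ c 2) => // [|p q ps|q qs].
  - exact: LS_multisetS.
  - apply: (is_LS_inserts (m := n.+1)) => //; first by rewrite (perm_mem ps).
    by rewrite (perm_all _ ps).
  - apply: is_LS_pair lds _; apply: perm_trans qs _; exact: LS_multisetS.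
apply: (perm_trans step2); exact/perm_flatten/perm_map.
Qed.

(** * Formal derivatives act as insertions *)

Section FormalDerivatives.
Variables (R : comNzRingType) (D : {linear lpoly R -> lpoly R}) (m : nat).
Hypothesis m_gt0 : (0 < m)%N.

Lemma derive_odd_weight p : formal_derivative (grammar_odd R m) D ->
  all (fun e => value e < m)%N p ->
  D (weight (var R) [::] (rcons p zero_entry)) =
    \sum_(q <- inserts [:: (m, true)] p) weight (var R) [::] (rcons q zero_entry).
Proof.
move=> [DM Dg] pm; apply: (derive_weight DM _ m_gt0 _ _ pm) => //.
  by move=> e; rewrite inE => /eqP->; rewrite ltnn.
move=> s b sm bm; rewrite (weight_insert_barred (var R) m_gt0 sm bm).
by apply: Dg; rewrite /grammar_odd (label_index_lt m_gt0 sm bm).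
Qed.

Lemma derive_even_weight p : formal_derivative (grammar_even R m) D ->
  all (lower_entry m) p ->
  D (weight (var R) [::] (rcons p zero_entry)) =
    \sum_(q <- inserts [:: (m, false); (m, false)] p)
      weight (var R) [::] (rcons q zero_entry).
Proof.
move=> [DM Dg] pm; apply: (derive_weight DM _ (lower_entry0 m_gt0) _ _ pm) => //.
  by move=> e; rewrite !inE => /orP[]/eqP->; rewrite /lower_entry eqxx andbF.
move=> s b sm bm; rewrite (weight_insert_pair (var R) m_gt0 sm bm).
apply: Dg; have := label_lower m_gt0 sm bm; rewrite /grammar_even.
(* A label of index below [m] is not u_m, so it falls in the x_m y_m z_m case, as v_m does. *)
have [lt _|_ /=] := ltnP.
  have /negPf-> : label s b != lU m by apply: contraTneq lt => ->; rewrite ltnn.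
  reflexivity.
case: eqP => [_ _|_ /= ->]; first reflexivity.
reflexivity.
Qed.

End FormalDerivatives.

(* [iteri m (fun k => D k.+1) f] is D_m (D_(m-1) ( ... (D_1 f))). *)
Theorem theorem3p1 (R : comNzRingType)
    (D : nat -> {linear lpoly R -> lpoly R})
    (hodd : forall n : nat, (1 <= n)%N ->
       formal_derivative (grammar_odd R n) (D (2 * n - 1)%N))
    (heven : forall n : nat, (1 <= n)%N ->
       formal_derivative (grammar_even R n) (D (2 * n)%N))
    (n : nat) (hn : (1 <= n)%N) :
  iteri (2 * n) (fun k => D k.+1) (x_ R 0) = LS_poly R n.
Proof.
rewrite LS_poly_weight //; elim: {hn} n => [|n IH].
  (* In terms of weights the induction starts at 0: the empty word has a single gap, from 0 to 0,
     labelled x_0. *)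
  have -> : LS_perms 0 = [:: [::]].
    by rewrite /LS_perms /LS_multiset /=; have -> : is_LS [::] by apply/is_LSP.
  rewrite muln0 big_seq1; exact: esym (mulr1 _).
rewrite mulnS /= IH linear_sum.
have E1 : (2 * n.+1 - 1)%N = (2 * n).+1 by lia.
have E2 : (2 * n.+1)%N = (2 * n).+2 by lia.
have := hodd n.+1 (ltn0Sn n); have := heven n.+1 (ltn0Sn n); rewrite E1 E2 => he ho.
rewrite (perm_big _ (perm_LS_perms n)) big_allpairs_dep big_allpairs_dep.
rewrite (eq_big_seq _ (fun p pn => derive_odd_weight (ltn0Sn n) ho (LS_perms_entries pn))).
rewrite linear_sum; apply: eq_big_seq => p pn; rewrite linear_sum; apply: eq_big_seq => q pq.
exact: derive_even_weight he (LS_perms_barred_entries pn pq).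
Qed.
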